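(* Let $b=2$. For every $n\ge2$, $$B(n)=K(\lceil n/2\rceil)+K(\lfloor n/2\rfloor)+2,\qquad K(n)=2^{B(n)}+1+K(\lfloor n/2\rfloor),$$ and $K(n)>2K(n-1)$.
   Context: Base $b=2$. For $v\in\mathbb{N}$, $s(v)$ is the number of ones in the binary expansion of $v$, $f(v)=v+s(v)$, and $F(u)=|\{v\in\mathbb{N}: f(v)=u\}|$. $K(n)$ is the smallest $u\in\mathbb{N}$ with $F(u)=n$ (so $K(1)=0$), and for $n\ge2$, $B(n)=\lfloor\log_2 K(n)\rfloor$. *)

(* Defs.v *)
From HB Require Import structures.
From mathcomp Require Import all_boot.
From mathcomp Require Import boolp classical_sets.

Set Implicit Arguments.
Unset Strict Implicit.
Unset Printing Implicit Defensive.

(* [trunc_log 2 v] is the position of the leading binary digit of [v > 0];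
   for [v = 0] the expansion is the single digit 0. *)
Definition s (v : nat) : nat :=
  #|[set i : 'I_(trunc_log 2 v).+1 | v %/ 2 ^ i %% 2 == 1]|.

Definition f (v : nat) : nat := v + s v.

(* As [v <= f v], all solutions of [f v = u] are at most [u]; see [F_spec]. *)
Definition F (u : nat) : nat := #|[set v : 'I_u.+1 | f v == u]|.

Lemma F_spec (u : nat) : exists t : seq nat,
  [/\ uniq t, forall v, (v \in t) = (f v == u) & size t = F u].
Proof.
exists [seq val i | i <- enum [set v : 'I_u.+1 | f v == u]]; split.
- by rewrite map_inj_uniq ?enum_uniq //; apply: val_inj.
- move=> v; apply/mapP/idP => [[i]|fv]; first by rewrite mem_enum inE => fi ->.
  have lt_vu : v < u.+1 by rewrite ltnS -(eqP fv) leq_addr.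
  by exists (Ordinal lt_vu); rewrite ?mem_enum ?inE.
- by rewrite size_map -cardE.
Qed.

(* The value 0 is used if no [u] satisfies [F u = n]. *)
Definition K (n : nat) : nat :=
  xget 0 [set u : nat | F u = n /\ forall w, F w = n -> u <= w]%classic.

Lemma K_spec (n : nat) : (exists u, F u = n) ->
  F (K n) = n /\ forall w, F w = n -> K n <= w.
Proof.
move=> [u0 Fu0]; have exF : exists u, F u == n by exists u0; apply/eqP.
case: (ex_minnP exF) => u /eqP Fu minu.
have Pu : [set u : nat | F u = n /\ forall w, F w = n -> u <= w]%classic u.
  by split=> // w /eqP; apply: minu.
exact: (xgetPex 0 (ex_intro _ u Pu)).
Qed.

Definition B (n : nat) : nat := trunc_log 2 (K n).

(* Main.v *)
Require Import Defs.
From mathcomp Require Import all_boot.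
From mathcomp Require Import zify.

(* For [v < 2 ^ m] one has [f (2 ^ m + v) = 2 ^ m + 1 + f v] and
   [f v + f (2 ^ m - 1 - v) = 2 ^ m - 1 + m].  Hence [F (2 ^ m) = F m.-1], and
   [F (2 ^ m + 1 + x)] equals [F x + F (m - 2 - x)] when [x <= m - 2] and [F x]
   otherwise.  A least [u] with [F u = n >= 2] therefore has the form
   [2 ^ (x + y + 2) + 1 + x] with [F x + F y = n] and [F x, F y > 0], so it
   first minimises [K a + K b] over [a + b = n] and then [x].  As [K] more than
   doubles at each step below [n], the minimum is attained only when [a] and [b]
   are the two halves of [n]; the doubling at [n] follows from the resulting
   recursion. *)

Lemma sum_digits_widen (v k j : nat) : v < 2 ^ k ->
  \sum_(i < k + j) (v %/ 2 ^ i %% 2 == 1) = \sum_(i < k) (v %/ 2 ^ i %% 2 == 1).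
Proof.
move=> ltv; rewrite big_split_ord /= [X in _ + X]big1 ?addn0 // => i _.
rewrite divn_small //; apply: leq_trans ltv _.
by rewrite leq_pexp2l // leq_addr.
Qed.

(** Leading zeros add nothing to the digit count, so any [m] with [v < 2 ^ m] can serve as the
    length. *)
Lemma s_sum (v m : nat) : v < 2 ^ m ->
  s v = \sum_(i < m) (v %/ 2 ^ i %% 2 == 1).
Proof.
move=> ltv; have ltv' : v < 2 ^ (trunc_log 2 v).+1 by apply: trunc_log_ltn.
rewrite /s cardsE -sum1_card big_mkcond /=.
transitivity (\sum_(i < (trunc_log 2 v).+1) (v %/ 2 ^ i %% 2 == 1)).
  by apply: eq_bigr => i _; rewrite unfold_in eqnE; case: eqP.
by rewrite -(sum_digits_widen v _ m ltv') addnC sum_digits_widen.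
Qed.

Lemma s_pow_add (m v : nat) : v < 2 ^ m -> s (2 ^ m + v) = (s v).+1.
Proof.
move=> ltv; rewrite (s_sum _ m.+1); last by rewrite expnS; lia.
rewrite (s_sum v m) // big_ord_recr /= divnDl // divnn expn_gt0 /=.
rewrite (divn_small ltv) /= addn1; congr _.+1; apply: eq_bigr => i _.
(* For [i < m], [2 ^ m] is an even multiple of [2 ^ i], so adding it leaves digit [i] unchanged. *)
have -> : 2 ^ m = 2 ^ (m - i).-1 * 2 * 2 ^ i.
  by rewrite -expnSr -expnD; congr (2 ^ _); have := ltn_ord i; lia.
by rewrite divnMDl ?expn_gt0 // modnMDl.
Qed.

(** Subtracting from [2 ^ m - 1] flips each of the [m] digits. The induction peels off the leading
    one. *)
Lemma s_compl (m v : nat) : v < 2 ^ m -> s v + s (2 ^ m - v.+1) = m.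
Proof.
elim: m v => [|m IH] v; first by case: v => // _; rewrite (s_sum _ 0) ?big_ord0.
rewrite expnS => ltv; have [ltvm|lemv] := ltnP v (2 ^ m).
  have -> : 2 * 2 ^ m - v.+1 = 2 ^ m + (2 ^ m - v.+1) by lia.
  by rewrite s_pow_add ?addnS ?IH //; lia.
have {ltv lemv} [w -> ltw] : exists2 w, v = 2 ^ m + w & w < 2 ^ m.
  by exists (v - 2 ^ m); lia.
have -> : 2 * 2 ^ m - (2 ^ m + w).+1 = 2 ^ m - w.+1 by lia.
by rewrite s_pow_add // addSn IH.
Qed.

Lemma F_sum (u N : nat) : u < N -> F u = \sum_(0 <= v < N) (f v == u).
Proof.
move=> ltu; rewrite /F cardsE -sum1_card big_mkcond /=.
rewrite (@big_cat_nat _ _ _ u.+1) //= [X in _ + X]big_nat_cond [X in _ + X]big1.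
  rewrite addn0 big_mkord; apply: eq_bigr => i _.
  by rewrite unfold_in eqnE; case: eqP.
by move=> v; rewrite andbT => /andP[ltuv _]; case: eqP => //; rewrite /f; lia.
Qed.

(* The solutions [v < 2 ^ m] are reflected through [v |-> 2 ^ m - 1 - v],
   the solutions [2 ^ m <= v] lose their leading digit. *)
Lemma F_split (m u : nat) : u < 2 ^ m.+1 ->
  F u = \sum_(0 <= v < 2 ^ m) (2 ^ m + 1 + f v == u)
      + \sum_(0 <= v < 2 ^ m) (f v + u + 1 == 2 ^ m + m).
Proof.
move=> ltu; rewrite (F_sum u _ ltu) (@big_cat_nat _ _ _ (2 ^ m)) //=; last first.
  by rewrite leq_exp2l.
rewrite addnC; congr (_ + _).
  rewrite -{1}[2 ^ m]add0n big_addn expnS mul2n -addnn addnK.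
  rewrite !big_mkord; apply: eq_bigr => v _.
  by rewrite /f [v + _]addnC s_pow_add //; congr nat_of_bool; lia.
rewrite big_nat_rev /= !big_mkord; apply: eq_bigr => v _.
have := s_compl m v (ltn_ord v); have := ltn_ord v.
by rewrite /f add0n => ltv sc; congr nat_of_bool; lia.
Qed.

Lemma F_pow (m : nat) : F (2 ^ m.+1) = F m.
Proof.
rewrite (F_split m.+1) ?ltn_exp2l // big1 => [|v _]; last by apply/eqP; lia.
rewrite (F_sum m (2 ^ m.+1)); last by apply: ltn_trans (ltn_expl m.+1 _).
by apply: eq_bigr => v _; congr nat_of_bool; lia.
Qed.

Lemma F_pow_addr (m x : nat) : x.+1 < 2 ^ m -> m < x + 2 ->
  F (2 ^ m + 1 + x) = F x.
Proof.
move=> ltx ltm; rewrite (F_split m); last by rewrite expnS; lia.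
rewrite [X in _ + X]big1 => [|v _]; last by apply/eqP; lia.
rewrite addn0 (F_sum x (2 ^ m)); last by lia.
by apply: eq_bigr => v _; congr nat_of_bool; lia.
Qed.

(** For this exponent the two conditions of [F_split] become [f v = x] and [f v = y]. *)
Lemma F_junction (x y : nat) : F (2 ^ (x + y + 2) + 1 + x) = F x + F y.
Proof.
have ltm : x + y + 2 < 2 ^ (x + y + 2) by apply: ltn_expl.
rewrite (F_split (x + y + 2)); last by rewrite expnS; lia.
rewrite (F_sum x (2 ^ (x + y + 2))) ?(F_sum y (2 ^ (x + y + 2))); try lia.
by congr (_ + _); apply: eq_bigr => v _; congr nat_of_bool; lia.
Qed.

Lemma F0 : F 0 = 1.
Proof. by rewrite (F_sum 0 1) // big_nat1 /f (s_sum 0 0) // big_ord0. Qed.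

Lemma F1 : F 1 = 0.
Proof.
by rewrite (F_split 0) // !big_nat1 /f (s_sum 0 0) // big_ord0.
Qed.

Lemma K1 : K 1 = 0.
Proof. by have [] := K_spec (ex_intro _ 0 F0) => _ /(_ 0 F0); lia. Qed.

Lemma F_surj (n : nat) : 0 < n -> exists u, F u = n.
Proof.
elim: n => // -[_ _|n IH _]; first by exists 0; apply: F0.
have [//|x Fx] := IH; exists (2 ^ (x + 0 + 2) + 1 + x).
by rewrite F_junction Fx F0 addn1.
Qed.

Lemma F_K (n : nat) : 0 < n -> F (K n) = n.
Proof. by move=> /F_surj/K_spec[]. Qed.

Lemma K_min (u : nat) : K (F u) <= u.
Proof. by have [_] := K_spec (ex_intro _ u erefl); apply. Qed.

(** Any other shape of [K n] would make [F] take the value [n] already at a smaller argument. *)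
Lemma K_decomp (n : nat) : 2 <= n -> exists x y,
  [/\ K n = 2 ^ (x + y + 2) + 1 + x, 0 < F x, 0 < F y & F x + F y = n].
Proof.
move=> n2; have FK := F_K n (ltnW n2).
have minK w : F w = n -> K n <= w by move <-; apply: K_min.
have Kn2 : 2 <= K n by move: FK; case: (K n) => [|[|//]]; rewrite ?F0 ?F1; lia.
have /andP[lem ltm] : 2 ^ trunc_log 2 (K n) <= K n < 2 ^ (trunc_log 2 (K n)).+1.
  by apply: trunc_log_bounds; lia.
have m0 : 0 < trunc_log 2 (K n) by rewrite trunc_log_gt0.
move: (trunc_log _ _) m0 lem ltm => [//|m] _ lem ltm.
have [eK|neK] := eqVneq (K n) (2 ^ m.+1).
  have := minK m; rewrite -F_pow -eK => /(_ FK).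
  by have := ltn_expl m.+1 (isT : 1 < 2); lia.
pose x := K n - 2 ^ m.+1 - 1.
have eK : K n = 2 ^ m.+1 + 1 + x by rewrite /x; lia.
have [ltmx|lexm] := ltnP m.+1 (x + 2).
  have := minK x; rewrite -(F_pow_addr m.+1) // -?eK; last first.
    by move: ltm; rewrite expnS; lia.
  by move=> /(_ FK); lia.
have em : m.+1 = x + (m.+1 - 2 - x) + 2 by lia.
move: (_ - _ - _) em => y em.
have ltxy : x + y + 2 < 2 ^ (x + y + 2) by apply: ltn_expl.
rewrite em in eK; have Fxy : F x + F y = n by rewrite -F_junction -eK.
exists x, y; split=> //.
  (* If one summand vanishes, the other equals [n], at an argument below [K n]. *)
  by rewrite lt0n; apply/eqP => Fx0; have := minK y; lia.
by rewrite lt0n; apply/eqP => Fy0; have := minK x; lia.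
Qed.

Lemma K_ge5 (n : nat) : 2 <= n -> 5 <= K n.
Proof.
move=> /K_decomp[x [y [-> _ _ _]]].
have : 2 ^ 2 <= 2 ^ (x + y + 2) by rewrite leq_pexp2l //; lia.
by lia.
Qed.

(** Doubling is assumed only below [n], so that this can be used inside the induction that proves
    doubling. *)
Lemma K_le_of_doubling (n : nat) :
    (forall k, 2 <= k < n -> 2 * K k.-1 < K k) ->
  forall a b, 0 < a <= b -> b < n -> K a <= K b.
Proof.
move=> dbl a b /andP[a0]; elim: b => [|b IH]; first by lia.
rewrite leq_eqVlt => /predU1P[-> //|]; rewrite ltnS => leab ltbn.
have : 2 * K b < K b.+1 by apply: (dbl b.+1); lia.
by have := IH leab (ltnW ltbn); lia.
Qed.

(* Unless [a] and [b] are the two halves of [n], the larger of them, say [b],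
   satisfies [K b > 2 * K b.-1 >= 2 * K (uphalf n)]. *)
Lemma K_halves_min (n a b : nat) :
    (forall k, 2 <= k < n -> 2 * K k.-1 < K k) ->
    0 < a <= b -> a + b = n -> K (uphalf n) + K n./2 <= K a + K b /\
  (K a + K b = K (uphalf n) + K n./2 -> a = n./2).
Proof.
move=> dbl /andP[a0 leab] eab; have mono := K_le_of_doubling n dbl.
have [eb|neb] := eqVneq b (uphalf n).
  have ea : a = n./2 by lia.
  by rewrite -ea -eb addnC.
have le1 : K n./2 <= K (uphalf n) by apply: mono; lia.
have le2 : K (uphalf n) <= K b.-1 by apply: mono; lia.
have : 2 * K b.-1 < K b by apply: dbl; lia.
by lia.
Qed.

Lemma K_rec (n : nat) :
    (forall k, 2 <= k < n -> 2 * K k.-1 < K k) -> 2 <= n ->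
  K n = 2 ^ (K (uphalf n) + K n./2 + 2) + 1 + K n./2.
Proof.
move=> dbl n2; set h := n./2; set c := uphalf n.
have mono : K h <= K c by apply: (K_le_of_doubling n dbl); rewrite /h /c; lia.
have le_K : K n <= 2 ^ (K c + K h + 2) + 1 + K h.
  have <- : F (2 ^ (K h + K c + 2) + 1 + K h) = n.
    by rewrite F_junction !F_K /h /c; lia.
  by rewrite [K h + _]addnC K_min.
have [x [y [eK Fx0 Fy0 Fxy]]] := K_decomp n n2.
have lex := K_min x; have ley := K_min y.
(* The order of [F x] and [F y] is unknown. If [F x] is the larger half [c], then [K h <= K (F x)]
   is [mono]. *)
have [le_sum eq_sum] : K c + K h <= K (F x) + K (F y) /\
    (K (F x) + K (F y) = K c + K h -> K h <= K (F x)).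
  have [le|/ltnW le] := leqP (F x) (F y).
    have [|//|? e] := K_halves_min n (F x) (F y) dbl; first by rewrite Fx0.
    by split=> // /e ->.
  have [||? e] := K_halves_min n (F y) (F x) dbl; [by rewrite Fy0|by lia|].
  rewrite [K (F x) + _]addnC; split=> // /e ey.
  by have -> : F x = c by rewrite /c; lia.
have ltxy : x < 2 ^ (x + y + 2).
  by apply: leq_trans (ltn_expl (x + y + 2) _) => //; lia.
(* A larger exponent at least doubles the leading power, which contradicts [le_K]. *)
have [ltm|lem] := ltnP (K c + K h) (x + y).
  have : 2 ^ (K c + K h + 2).+1 <= 2 ^ (x + y + 2) by rewrite leq_exp2l //; lia.
  have := ltn_expl (K c + K h + 2) (isT : 1 < 2).
  by move: le_K; rewrite eK expnS; lia.
(* Now [K (F x) + K (F y)] lies between equal bounds, so [eq_sum] gives [K h <= x], and [le_K] gives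
   the converse. *)
have exy : x + y = K c + K h by lia.
have : K h <= K (F x) by apply: eq_sum; lia.
by move: le_K; rewrite eK exy; lia.
Qed.

(** From [n.-1] to [n] exactly one half grows, by one. This raises the exponent [b] in [K_rec] by at
    least 2, and [4 * 2 ^ b] exceeds twice [K n.-1]. *)
Lemma K_gt_double (n : nat) : 2 <= n -> 2 * K n.-1 < K n.
Proof.
elim/ltn_ind: n => n IH n2.
have dbl k : 2 <= k < n -> 2 * K k.-1 < K k by move=> /andP[k2 /IH]; apply.
have [->|n3] := eqVneq n 2; first by rewrite K1; have := K_ge5 2; lia.
rewrite (K_rec n dbl n2) (K_rec n.-1); [|by move=> k kn; apply: dbl; lia|by lia].
have leB : K (uphalf n.-1) + K n.-1./2 + 2 <= K (uphalf n) + K n./2.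
  (* Doubling alone gives a gap of 2 only if [K k.-1] is positive; [K_ge5] covers [K 1 = 0]. *)
  have gap k : 2 <= k < n -> K k.-1 + 2 <= K k.
    by move=> kn; have := dbl k kn; have := K_ge5 k; lia.
  have [on|en] := boolP (odd n).
    have -> : uphalf n.-1 = n./2 by lia.
    have -> : n.-1./2 = (uphalf n).-1 by lia.
    by have := gap (uphalf n); lia.
  have -> : uphalf n.-1 = uphalf n by lia.
  have -> : n.-1./2 = n./2.-1 by lia.
  by have := gap n./2; lia.
set b := _ + 2 in leB *.
have : 2 ^ b.+2 <= 2 ^ (K (uphalf n) + K n./2 + 2) by rewrite leq_exp2l //; lia.
have := ltn_expl b (isT : 1 < 2).
by rewrite !expnS /b; lia.
Qed.

Theorem theorem5p1 (n : nat) (hn : 2 <= n) :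
  [/\ B n = K (uphalf n) + K n./2 + 2,
      K n = 2 ^ B n + 1 + K n./2
    & 2 * K n.-1 < K n].
Proof.
have eK : K n = 2 ^ (K (uphalf n) + K n./2 + 2) + 1 + K n./2.
  by apply: K_rec => // k /andP[k2 _]; apply: K_gt_double.
have eB : B n = K (uphalf n) + K n./2 + 2.
  (* The tail [1 + K n./2] is smaller than the leading power, so it does not change the
     logarithm. *)
  rewrite /B; apply: trunc_log_eq => //.
  have := ltn_expl (K (uphalf n) + K n./2 + 2) (isT : 1 < 2).
  by rewrite eK expnS; lia.
by split; [|rewrite eB|apply: K_gt_double].
Qed.
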